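(* Let $f\colon\mathbb{R}^n\to\mathbb{R}\cup\{+\infty\}$ be a lower semi-continuous semi-algebraic function and let $S\subset\mathbb{R}^n$ be a closed semi-algebraic set such that $\mathrm{dom} f\cap S$ is nonempty and unbounded. Assume that the qualification condition at infinity $(\mathrm{QC})_\infty$ holds. Then $f$ is bounded from below on $S$ if and only if $$\min_{k=1,\ldots,p}\lambda_k>-\infty.$$
   Context: Conventions. $\|\cdot\|$ is the Euclidean norm on $\mathbb{R}^n$; $\mathbb{B}_R$ and $\mathbb{S}_R$ are the closed ball and the sphere of radius $R>0$ centered at $0$. A subset of $\mathbb{R}^n$ is semi-algebraic if it is a finite union of sets, each defined by finitely many polynomial equalities and strict inequalities; a map is semi-algebraic if its graph is (for $f\colon\mathbb{R}^n\to\mathbb{R}\cup\{+\infty\}$ the graph is $\{(x,y)\in\mathbb{R}^n\times\mathbb{R}\mid y=f(x)\}$). $\mathrm{dom} f=\{x\mid f(x)<+\infty\}$, $\mathrm{epi} f=\{(x,\alpha)\in\mathbb{R}^n\times\mathbb{R}\mid f(x)\le\alpha\}$. Normals and subdifferentials. For $x\in S\subset\mathbb{R}^n$, the regular normal cone $\widehat N(x;S)$ is the set of $v$ with $\langle v,x'-x\rangle\le o(\|x'-x\|)$ as $x'\to x$, $x'\in S$. The limiting normal cone $N(x;S)$ is the set of $v$ for which there are $x_k\to x$, $x_k\in S$, and $v_k\to v$ with $v_k\in\widehat N(x_k;S)$. For $x\in\mathrm{dom} f$: $\partial f(x)=\{v\mid (v,-1)\in N((x,f(x));\mathrm{epi}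 f)\}$ and $\partial^\infty f(x)=\{v\mid (v,0)\in N((x,f(x));\mathrm{epi} f)\}$. $(\mathrm{QC})_\infty$: there exists $R>0$ such that $\partial^\infty f(x)\cap(-N(x;S))=\{0\}$ for all $x\in(\mathrm{dom} f\cap S)\setminus\mathbb{B}_R$. Tangency variety: $\Gamma(f,S)=\{x\in\mathrm{dom} f\cap S\mid \exists\mu\in\mathbb{R}:\ 0\in\partial f(x)+N(x;S)+\mu x\}$ (a semi-algebraic set). Decomposition at infinity. Fix a finite partition of $\Gamma(f,S)$ into semi-algebraic sets $C_1,\ldots,C_\ell$ on each of which $f$ is continuous. By Hardt's triviality theorem applied to $x\mapsto\|x\|$ on $\Gamma(f,S)$, there are $R>0$, semi-algebraic sets $F_1,\ldots,F_\ell$ and a semi-algebraic homeomorphism $h\colon(\cup_i F_i)\times(R,+\infty)\to\Gamma(f,S)\setminus\mathbb{B}_R$ with $\|h(x,t)\|=t$ and $h(F_i\times(R,+\infty))=C_i\setminus\mathbb{B}_R$ for all $i$. Let $\Gamma_1,\ldots,\Gamma_p$ be the sets $h(F'\times(R,+\infty))$, with $F'$ running over the connected components of $F_1,\ldots,F_\ell$. Thus $\Gamma(f,S)\setminus\mathbb{B}_R$ is the disjoint union of the semi-algebraic sets $\Gamma_k$; each $\Gamma_k$ is connected and unbounded, $\Gamma_k\cap\mathbb{S}_t$ is nonempty and connected for each $t>R$, and $f|_{\Gamma_k}$ is continuous. $R$ may be increased to $R'$ by restricting $h$, i.e. replacing $\Gamma_k$ by $\Gamma_k\setminus\mathbb{B}_{R'}$.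 Under $(\mathrm{QC})_\infty$, for $R$ large enough $f$ is constant on each $\Gamma_k\cap\mathbb{S}_t$, $t>R$, so $f_k\colon(R,+\infty)\to\mathbb{R}$, $f_k(t):=f(x)$ for any $x\in\Gamma_k\cap\mathbb{S}_t$, is well defined; it is semi-algebraic, hence $\lambda_k:=\lim_{t\to+\infty}f_k(t)\in\mathbb{R}\cup\{\pm\infty\}$ exists. $R$ is fixed sufficiently large (the claim is for all sufficiently large $R$). *)

(* Defs.v *)
From HB Require Import structures.
From mathcomp Require Import all_boot all_order all_algebra.
From mathcomp Require Import all_classical all_reals all_analysis.
(* the notations of mpoly clash with those of the analysis library *)
From mathcomp Require Import -(notations) mpoly.

Set Implicit Arguments.
Unset Strict Implicit.
Unset Printing Implicit Defensive.

Import Order.TTheory GRing.Theory Num.Theory.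
Import numFieldNormedType.Exports.

Local Open Scope classical_set_scope.
Local Open Scope ring_scope.

(* R^n is 'rV[R]_n with its canonical (product) topology.  The canonical norm
   `|x| on that type is the sup norm, so the Euclidean one is defined here. *)
Definition dot (R : realType) (n : nat) (u v : 'rV[R]_n) : R :=
  \sum_(i < n) u 0 i * v 0 i.

Definition enorm (R : realType) (n : nat) (x : 'rV[R]_n) : R :=
  Num.sqrt (dot x x).

Definition eball (R : realType) (n : nat) (r : R) : set 'rV[R]_n :=
  [set x | enorm x <= r].

Definition esphere (R : realType) (n : nat) (r : R) : set 'rV[R]_n :=
  [set x | enorm x = r].

Definition eunbounded (R : realType) (n : nat) (A : set 'rV[R]_n) :=
  forall M : R, exists2 x, A x & M < enorm x.

(* (x, a) in R^n x R, as a vector of R^(n+1) *)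
Definition pair_rv (R : realType) (n : nat) (x : 'rV[R]_n) (a : R) :
  'rV[R]_(n + 1) := row_mx x (const_mx a).

(* Each b in s describes the set where the polynomials of b.1 vanish and
   those of b.2 are positive. *)
Definition semialgebraic (R : realType) (n : nat) (A : set 'rV[R]_n) :=
  exists s : seq (seq (mpoly n R) * seq (mpoly n R)),
    A = [set x | exists2 b, b \in s &
          (forall q, q \in b.1 -> meval (fun i => x 0 i) q = 0) /\
          (forall q, q \in b.2 -> 0 < meval (fun i => x 0 i) q)].

Definition semialgebraic_fun (R : realType) (n : nat) (f : 'rV[R]_n -> \bar R) :=
  semialgebraic [set z | exists x y, z = pair_rv x y /\ y%:E = f x].

Definition edom (R : realType) (n : nat) (f : 'rV[R]_n -> \bar R) :
  set 'rV[R]_n := [set x | (f x < +oo)%E].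

Definition epi (R : realType) (n : nat) (f : 'rV[R]_n -> \bar R) :
  set 'rV[R]_(n + 1) :=
  [set z | exists x a, z = pair_rv x a /\ (f x <= a%:E)%E].

Definition regular_normal (R : realType) (n : nat) (S : set 'rV[R]_n)
    (x : 'rV[R]_n) : set 'rV[R]_n :=
  [set v | forall e : R, 0 < e ->
     \forall y \near x, S y -> dot v (y - x) <= e * enorm (y - x)].

Definition limiting_normal (R : realType) (n : nat) (S : set 'rV[R]_n)
    (x : 'rV[R]_n) : set 'rV[R]_n :=
  [set v | exists xs vs : nat -> 'rV[R]_n,
     [/\ forall k, S (xs k) /\ regular_normal S (xs k) (vs k),
         xs @ \oo --> x & vs @ \oo --> v]].

(* The two subdifferentials are meaningful at points of edom f, where
   fine (f x) is the real value of f (f never takes the value -oo). *)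
Definition subdiff (R : realType) (n : nat) (f : 'rV[R]_n -> \bar R)
    (x : 'rV[R]_n) : set 'rV[R]_n :=
  [set v | limiting_normal (epi f) (pair_rv x (fine (f x))) (pair_rv v (-1))].

Definition singular_subdiff (R : realType) (n : nat) (f : 'rV[R]_n -> \bar R)
    (x : 'rV[R]_n) : set 'rV[R]_n :=
  [set v | limiting_normal (epi f) (pair_rv x (fine (f x))) (pair_rv v 0)].

Definition qc_infty (R : realType) (n : nat) (f : 'rV[R]_n -> \bar R)
    (S : set 'rV[R]_n) :=
  exists2 r : R, 0 < r & forall x, ((edom f `&` S) `\` eball r) x ->
    singular_subdiff f x `&` [set - w | w in limiting_normal S x] = [set 0].

Definition tangency (R : realType) (n : nat) (f : 'rV[R]_n -> \bar R)
    (S : set 'rV[R]_n) : set 'rV[R]_n :=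
  [set x | [/\ edom f x, S x & exists mu : R, exists v w : 'rV[R]_n,
     [/\ subdiff f x v, limiting_normal S x w & 0 = v + w + mu *: x]]].

(* h is total; only its restriction to D matters *)
Definition semialgebraic_homeo (R : realType) (m n : nat)
    (D : set ('rV[R]_m * R)) (E : set 'rV[R]_n) (h : 'rV[R]_m * R -> 'rV[R]_n) :=
  [/\ set_bij D E h,
      {within D, continuous h},
      exists2 g : 'rV[R]_n -> 'rV[R]_m * R,
        {in D, cancel h g} & {within E, continuous g} &
      semialgebraic [set row_mx (pair_rv u.1 u.2) (h u) | u in D]].

(* C : the partition of the tangency variety, F and h : the trivialisation
   given by Hardt's theorem, Gam : the pieces indexed from 0 to p - 1. *)
Record decomposition_at_infinity (R : realType) (n l m p : nat)
    (f : 'rV[R]_n -> \bar R) (S : set 'rV[R]_n) (r : R)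
    (C : 'I_l -> set 'rV[R]_n) (F : 'I_l -> set 'rV[R]_m)
    (h : 'rV[R]_m * R -> 'rV[R]_n) (Gam : 'I_p -> set 'rV[R]_n) : Prop :=
  DecompositionAtInfinity {
    dec_partition : partition setT C (tangency f S);
    dec_C_semialg : forall i, semialgebraic (C i);
    dec_C_cont : forall i, {within C i, continuous f};
    dec_radius : 0 < r;
    dec_F_semialg : forall i, semialgebraic (F i);
    dec_homeo : semialgebraic_homeo ((\bigcup_i F i) `*` `]r, +oo[)
                  (tangency f S `\` eball r) h;
    dec_norm : forall x t, (\bigcup_i F i) x -> r < t -> enorm (h (x, t)) = t;
    dec_C : forall i, h @` (F i `*` `]r, +oo[) = C i `\` eball r;
    dec_Gam_inj : injective Gam;
    dec_Gam : range Gam =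
      [set G | exists i a, F i a /\
         G = h @` (connected_component (F i) a `*` `]r, +oo[)] }.

(* fk is the function t |-> f(x), for any x in G with enorm x = t, t > r *)
Definition radial_value (R : realType) (n : nat) (f : 'rV[R]_n -> \bar R)
    (r : R) (G : set 'rV[R]_n) (fk : R -> R) :=
  forall t, r < t -> forall x, (G `&` esphere t) x -> f x = (fk t)%:E.

Definition lambda (R : realType) (fk : R -> R) : \bar R :=
  lim ((fk t)%:E @[t --> +oo]).

Definition bounded_below_on (R : realType) (n : nat) (f : 'rV[R]_n -> \bar R)
    (S : set 'rV[R]_n) :=
  exists M : R, forall x, S x -> (M%:E <= f x)%E.

(* Main.v *)
Require Import Defs.
From mathcomp Require Import all_boot all_order all_algebra.
From mathcomp Require Import all_classical all_reals all_analysis.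
From mathcomp Require Import -(notations) mpoly.
From mathcomp Require Import -(notations) polyrcf ordered_qelim qe_rcf.
From mathcomp Require Import ring lra.

Set Implicit Arguments.
Unset Strict Implicit.
Unset Printing Implicit Defensive.

Import Order.TTheory GRing.Theory Num.Theory.
Import numFieldNormedType.Exports.
Local Open Scope classical_set_scope.
Local Open Scope ring_scope.

(** Outside a large ball, the infimum of [f] over [S] is already seen on the
tangency variety.  Let [T] be at least the radius of the qualification
condition and let [x1] be a point of [S], with [f x1] finite, outside the ball
of radius [T].  Minimise the penalised function
[f x + K * (|x|^2 - |x1|^2)^2] over the part of [S] lying in a thin annulus
around the sphere through [x1].  A minimiser [x0] satisfies [f x0 <= f x1], and
for [K] large it is interior to the annulus; so, near [x0], [f] is minorised on
[S] by a smooth function of [|x|^2] which agrees with it at [x0].  The gradient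
of that function at [x0] is a multiple of [x0], and the sum rule for [f] and the
indicator of [S] yields [0 = v + w + mu *: x0] with [v] a subgradient and [w] a
normal: [x0] is a tangency point (lemma [tangency_below]).  The sphere enters
through a smooth penalty and not as a constraint, so the qualification condition
for [f] and [S] at [x0] is exactly what the sum rule asks for.

The sum rule is proved by decoupling the variables.  Minimise
[f x + j * |x - y|^2] plus a quadratic perturbation over [x] near [x0] and [y] in
[S] near [x0]; as [j] grows the minimisers tend to [(x0, x0)], and optimality in
[x] and in [y] gives a proximal subgradient of [f] and a proximal normal to [S]
which almost cancel ([fuzzy_sum_rule]).  Rescaling these to unit size gives a
cluster point; if the rescaling factor tends to [0], the limit is a nonzero
horizontal normal to the epigraph opposite to a normal of [S], which the
qualification condition forbids ([sum_rule]).

Each [f_k] has a limit.  By quantifier elimination over real closed fields, for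
every level [c] the set of radii [t] at which [f] takes the value [c] on a given
semi-algebraic piece of the variety contains, or avoids, a neighbourhood of
[+oo] ([level_eventually]).  If the continuous function [f_k] oscillated, it
would cross a whole interval of levels infinitely often, so that all these levels
would eventually be taken at each radius; but at a given radius only [p] levels
are available ([no_oscillation]).

The theorem follows.  If [f >= M] on [S], each [f_k], hence each [lambda_k], is at
least [M].  Conversely, if every [lambda_k] exceeds [-oo], the [f_k] are bounded
below near [+oo], so [f] is bounded below on the variety outside a ball, hence on
[S] outside that ball; inside the ball, lower semicontinuity and compactness
bound [f]. *)

(** * Definable sets of radii are eventually constant *)

(** A nonzero polynomial has no root beyond its Cauchy bound, and then
keeps the sign of its leading coefficient. *)
Lemma poly_sg_eventually (R : realType) (q : {poly R}) :
  exists s : R, \forall t \near +oo, Num.sg q.[t] = s.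
Proof.
have [->|q0] := eqVneq q 0.
  by exists 0; near=> t; rewrite horner0 sgr0.
exists (sgp_pinfty q); near=> t.
apply: (sgp_pinftyP (ge_cauchy_bound q0)).
by rewrite in_itv /= andbT; near: t; apply: nbhs_pinfty_ge; exact: num_real.
Unshelve. all: by end_near. Qed.

(** An environment with a single entry gives the value [0] to all variables
but the first one. *)
Lemma rterm_poly (R : realType) (u : GRing.term R) : GRing.rterm u ->
  exists q : {poly R}, forall t, GRing.eval [:: t] u = q.[t].
Proof.
elim: u => //=.
- case=> [|k] _; first by exists 'X => t; rewrite hornerX.
  by exists 0 => t; rewrite horner0; case: k.
- by move=> c _; exists c%:P => t; rewrite hornerC.
- by move=> k _; exists k%:R%:P => t; rewrite hornerC.
- move=> u IHu v IHv /andP[/IHu[q qE] /IHv[q' q'E]].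
  by exists (q + q') => t; rewrite hornerD qE q'E.
- by move=> u IHu /IHu[q qE]; exists (- q) => t; rewrite hornerN qE.
- by move=> u IHu k /IHu[q qE]; exists (q *+ k) => t; rewrite hornerMn qE.
- move=> u IHu v IHv /andP[/IHu[q qE] /IHv[q' q'E]].
  by exists (q * q') => t; rewrite hornerM qE q'E.
- by move=> u IHu k /IHu[q qE]; exists (q ^+ k) => t; rewrite horner_exp qE.
Qed.

Lemma qf_eval_eventually (R : realType) (g : ord.formula R) :
  ord.qf_form g -> ord.rformula g ->
  exists b : bool, \forall t \near +oo, ord.qf_eval [:: t] g = b.
Proof.
have atom (u v : GRing.term R) : GRing.rterm u && GRing.rterm v ->
    exists s : R, \forall t \near +oo,
      Num.sg (GRing.eval [:: t] v - GRing.eval [:: t] u) = s.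
  move=> /andP[/rterm_poly[q qE] /rterm_poly[q' q'E]].
  have [s Hs] := poly_sg_eventually (q' - q); exists s.
  by apply: filterS Hs => t; rewrite hornerD hornerN qE q'E.
elim: g => //=.
- by move=> b _ _; exists b; near=> t.
- move=> u v _ /atom[s Hs]; exists (s == 0); apply: filterS Hs => t <-.
  by rewrite sgr_eq0 subr_eq0 eq_sym.
- move=> u v _ /atom[s Hs]; exists (0 < s); apply: filterS Hs => t <-.
  by rewrite sgr_gt0 subr_gt0.
- move=> u v _ /atom[s Hs]; exists (0 <= s); apply: filterS Hs => t <-.
  by rewrite sgr_ge0 subr_ge0.
- move=> f IHf g IHg /andP[qf qg] /andP[rf rg].
  have [b Hb] := IHf qf rf; have [c Hc] := IHg qg rg.
  by exists (b && c); near=> t; congr andb; near: t.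
- move=> f IHf g IHg /andP[qf qg] /andP[rf rg].
  have [b Hb] := IHf qf rf; have [c Hc] := IHg qg rg.
  by exists (b || c); near=> t; congr orb; near: t.
- move=> f IHf g IHg /andP[qf qg] /andP[rf rg].
  have [b Hb] := IHf qf rf; have [c Hc] := IHg qg rg.
  by exists (b ==> c); near=> t; congr implb; near: t.
- move=> f IHf qf rf; have [b Hb] := IHf qf rf.
  by exists (~~ b); near=> t; congr negb; near: t.
Unshelve. all: by end_near. Qed.

(** Quantifier elimination turns the formula into a Boolean combination of
sign conditions on polynomials in the single free variable. This is the
o-minimality of the real field, localised at [+oo]. *)
Lemma holds_eventually (R : realType) (g : ord.formula R) : ord.rformula g ->
  (\forall t \near +oo, ord.holds [:: t] g) \/
  (\forall t \near +oo, ~ ord.holds [:: t] g).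
Proof.
move=> rg.
have qeP t := @ord.quantifier_elim_rformP R _ (@wf_QE_wproj R)
  (@valid_QE_wproj R) [:: t] g rg.
have /andP[qf rf] := @ord.quantifier_elim_wf R _ (@wf_QE_wproj R) g rg.
have [[] Hb] := qf_eval_eventually qf rf; [left|right]; apply: filterS Hb => t.
  by move=> /qeP.
by move=> e /qeP; rewrite e.
Qed.

Definition mpoly_term (R : realType) (n : nat) (s : 'I_n -> GRing.term R)
    (q : mpoly n R) : GRing.term R :=
  \big[@GRing.Add R/@GRing.NatConst R 0]_(m <- msupp q)
    GRing.Mul (GRing.Const (mcoeff m q))
      (\big[@GRing.Mul R/@GRing.NatConst R 1]_(i < n) GRing.Exp (s i) (m i)).

Lemma eval_mpoly_term (R : realType) (n : nat) (s : 'I_n -> GRing.term R)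
    (q : mpoly n R) e :
  GRing.eval e (mpoly_term s q) = meval (fun i => GRing.eval e (s i)) q.
Proof.
rewrite mevalE /mpoly_term (big_morph (GRing.eval e) (id1 := 0) (op1 := +%R))//=.
apply: eq_bigr => m _; congr (_ * _).
by rewrite (big_morph (GRing.eval e) (id1 := 1) (op1 := *%R)).
Qed.

Lemma rterm_mpoly_term (R : realType) (n : nat) (s : 'I_n -> GRing.term R)
    (q : mpoly n R) : (forall i, GRing.rterm (s i)) ->
  GRing.rterm (mpoly_term s q).
Proof.
move=> rs; rewrite /mpoly_term.
apply: (big_ind (@GRing.rterm R)) => // [x y /= -> ->//|m _ /=].
by apply: (big_ind (@GRing.rterm R)) => // [x y /= -> ->//|i _]; exact: rs.
Qed.

Definition and_formulas (R : realType) (s : seq (ord.formula R)) :=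
  foldr (@ord.And R) (ord.Bool true) s.

Definition or_formulas (R : realType) (s : seq (ord.formula R)) :=
  foldr (@ord.Or R) (ord.Bool false) s.

Lemma holds_and (R : realType) (T : eqType) (g : T -> ord.formula R)
    (s : seq T) e :
  ord.holds e (and_formulas (map g s)) <->
  (forall x, x \in s -> ord.holds e (g x)).
Proof.
elim: s => [|a s IHs] /=; first by split.
split=> [[ga /IHs gs] x|gs].
  by rewrite inE => /predU1P[->//|]; exact: gs.
split; first by apply: gs; rewrite mem_head.
by apply/IHs => x xs; apply: gs; rewrite inE xs orbT.
Qed.

Lemma holds_or (R : realType) (T : eqType) (g : T -> ord.formula R)
    (s : seq T) e :
  ord.holds e (or_formulas (map g s)) <->
  (exists2 x, x \in s & ord.holds e (g x)).
Proof.
elim: s => [|a s IHs] /=; first by split=> [|[x]].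
split=> [[ga|/IHs[x xs gx]]|[x]].
- by exists a; rewrite ?mem_head.
- by exists x => //; rewrite inE xs orbT.
by rewrite inE => /predU1P[->|xs gx]; [left|right; apply/IHs; exists x].
Qed.

Lemma rformula_and (R : realType) (s : seq (ord.formula R)) :
  ord.rformula (and_formulas s) = all (@ord.rformula R) s.
Proof. by elim: s => //= a s ->. Qed.

Lemma rformula_or (R : realType) (s : seq (ord.formula R)) :
  ord.rformula (or_formulas s) = all (@ord.rformula R) s.
Proof. by elim: s => //= a s ->. Qed.

(** The coordinates are replaced by arbitrary terms, so that the same set can
be used inside formulas with other variables and with parameters. *)
Lemma semialgebraic_formula (R : realType) (n : nat) (A : set 'rV[R]_n)
    (s : 'I_n -> GRing.term R) :
  semialgebraic A -> (forall i, GRing.rterm (s i)) ->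
  exists2 g : ord.formula R, ord.rformula g &
    forall e, ord.holds e g <-> A (\row_i GRing.eval e (s i)).
Proof.
move=> [bs ->] rs; pose T := mpoly_term s.
pose G (b : seq (mpoly n R) * seq (mpoly n R)) := ord.And
  (and_formulas [seq ord.Equal (T q) (GRing.NatConst R 0) | q <- b.1])
  (and_formulas [seq ord.Lt (GRing.NatConst R 0) (T q) | q <- b.2]).
have TE e q : GRing.eval e (T q) =
    meval (fun i => (\row_i GRing.eval e (s i)) 0 i) q.
  by rewrite eval_mpoly_term; congr meval; apply/funext => i; rewrite mxE.
exists (or_formulas (map G bs)) => [|e].
  rewrite rformula_or all_map; apply/allP => b _ /=.
  rewrite !rformula_and !all_map; apply/andP.
  by split; apply/allP => q _ /=; rewrite rterm_mpoly_term.
rewrite holds_or; split=> -[b bbs] [b1 b2]; exists b => //; split.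
- by move=> q qb; rewrite -TE; exact: ((holds_and _ _ _).1 b1 q qb).
- by move=> q qb; rewrite -TE; exact: ((holds_and _ _ _).1 b2 q qb).
- by apply/holds_and => q /b1 /=; rewrite TE.
- by apply/holds_and => q /b2 /=; rewrite TE.
Qed.

Lemma holds_exists_tail (R : realType) (g : ord.formula R) (n : nat) (t : R) :
  ord.holds [:: t] (foldr (@ord.Exists R) g (iota 1 n)) <->
  exists x : 'rV[R]_n, ord.holds (t :: [seq x 0 i | i : 'I_n]) g.
Proof.
suff key k (e : seq R) : size e = k ->
    ord.holds e (foldr (@ord.Exists R) g (iota k n)) <->
    exists2 v : seq R, size v = n & ord.holds (e ++ v) g.
  rewrite key//; split=> [[v vn gv]|[x gx]]; last first.
    by exists [seq x 0 i | i : 'I_n] => //; rewrite size_map size_enum_ord.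
  exists (\row_i nth 0 v i).
  rewrite [X in _ :: X](_ : _ = v)//.
  apply: (@eq_from_nth _ 0); rewrite size_map size_enum_ord// => i ni.
  by rewrite (nth_map (Ordinal ni)) ?size_enum_ord// mxE nth_enum_ord.
elim: n k e => [|n IHn] k e ek /=.
  split=> [he|[v /size0nil->]]; last by rewrite cats0.
  by exists [::] => //; rewrite cats0.
have sE x : set_nth 0 e k x = rcons e x.
  by rewrite -ek; elim: (e) => //= a l ->.
split=> [[x]|[[//|x v] [vn] hv]].
  rewrite sE => /(IHn k.+1)[|v vn]; first by rewrite size_rcons ek.
  by rewrite cat_rcons => hv; exists (x :: v) => //=; rewrite vn.
exists x; rewrite sE; apply/(IHn k.+1); first by rewrite size_rcons ek.
by exists v => //; rewrite cat_rcons.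
Qed.

(** The condition is first order in [t]: the point [x] is quantified
existentially, and [enorm x = t] is the polynomial equation
[dot x x = t * t] when [t >= 0]. *)
Lemma level_eventually (R : realType) (n : nat) (f : 'rV[R]_n -> \bar R)
    (A : set 'rV[R]_n) (c : R) :
  semialgebraic_fun f -> semialgebraic A ->
  let P t := exists2 x, A x & enorm x = t /\ f x = c%:E in
  (\forall t \near +oo, P t) \/ (\forall t \near +oo, ~ P t).
Proof.
move=> fsa Asa P.
pose X (i : 'I_n) := GRing.Var R i.+1.
have [gA rA gAE] := semialgebraic_formula (s := X) Asa (fun=> isT).
pose Y (i : 'I_(n + 1)) := match fintype.split i with
  | inl j => X j | inr _ => GRing.Const c end.
have rY i : GRing.rterm (Y i) by rewrite /Y; case: fintype.split.
have [gf rf gfE] := semialgebraic_formula fsa rY.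
pose N := \big[@GRing.Add R/@GRing.NatConst R 0]_(i < n) GRing.Mul (X i) (X i).
pose gN := ord.Equal N (GRing.Mul (GRing.Var R 0) (GRing.Var R 0)).
pose g := foldr (@ord.Exists R) (ord.And gA (ord.And gf gN)) (iota 1 n).
have rg : ord.rformula g.
  rewrite /g; elim: (iota 1 n) => //=; rewrite rA rf andbT /=.
  by apply: (big_ind (@GRing.rterm R)) => // x y /= -> ->.
have XE t (x : 'rV[R]_n) i :
    GRing.eval (t :: [seq x 0 i | i : 'I_n]) (X i) = x 0 i.
  by rewrite /= (nth_map i) ?size_enum_ord// nth_ord_enum.
have PE : \forall t \near +oo, P t <-> ord.holds [:: t] g.
  near=> t; have t0 : 0 <= t by near: t; apply: nbhs_pinfty_ge; exact: num_real.
  have gxE (x : 'rV[R]_n) : ord.holds (t :: [seq x 0 i | i : 'I_n])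
      (ord.And gA (ord.And gf gN)) <-> A x /\ enorm x = t /\ f x = c%:E.
    have gAx : ord.holds (t :: [seq x 0 i | i : 'I_n]) gA <-> A x.
      rewrite gAE (_ : \row_i _ = x)//.
      by apply/rowP => i; rewrite mxE XE.
    have gfx : ord.holds (t :: [seq x 0 i | i : 'I_n]) gf <-> f x = c%:E.
      rewrite gfE /= (_ : \row_i _ = pair_rv x c); last first.
        apply/rowP => i; rewrite !mxE /Y; case: fintype.split => j.
          exact: XE.
        by rewrite mxE.
      split=> [[y [a []]]|fx]; last by exists x, c.
      by move=> /eq_row_mx[-> /matrixP/(_ 0 0)]; rewrite !mxE => -> ->.
    have gNx : ord.holds (t :: [seq x 0 i | i : 'I_n]) gN <-> enorm x = t.
      rewrite /= (big_morph (GRing.eval _) (id1 := 0) (op1 := +%R))//=.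
      rewrite (eq_bigr (fun i => x 0 i * x 0 i)) => [|i _]; last first.
        by have /= -> := XE t x i.
      rewrite /enorm /dot; split=> [->|<-].
        by rewrite -expr2 sqrtr_sqr ger0_norm.
      by rewrite -expr2 sqr_sqrtr// sumr_ge0// => i _; rewrite -expr2 sqr_ge0.
    by rewrite /=; tauto.
  rewrite /g holds_exists_tail /P; split=> [[x Ax H]|[x /gxE[Ax H]]].
    by exists x; apply/gxE.
  by exists x.
have [H|H] := holds_eventually rg; [left|right]; apply: filterS2 PE H => t.
  by move=> ->.
by move=> PE nh /PE.
Unshelve. all: by end_near. Qed.

(** * Limits of branches of a plane curve *)

Lemma frequently_pinfty (R : realType) (Q : set R) :
  ~ (\forall t \near +oo, Q t) -> forall T, exists2 t, T < t & ~ Q t.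
Proof.
move=> nQ T; apply: contrapT => H; apply: nQ.
near=> t; apply: contrapT => nQt; apply: H; exists t => //.
near: t; apply: nbhs_pinfty_gt; exact: num_real.
Unshelve. all: by end_near. Qed.

Lemma eventually_pinfty_from (R : realType) (Q : set R) (r : R) :
  (\forall t \near +oo, Q t) -> exists2 T, r <= T & forall t, T < t -> Q t.
Proof.
move=> [T [_ HT]]; exists (Num.max r T); first by rewrite le_max lexx.
by move=> t; rewrite gt_max => /andP[_ /HT].
Qed.

(** Here [P c t] stands for: the level [c] is attained at radius [t] by one
of the [p] branches. An oscillating branch crosses every level between [a] and
[b] infinitely often, so each of these levels is eventually attained for
good; choosing [p + 1] of them contradicts the pigeonhole principle. *)
Lemma no_oscillation (R : realType) (p : nat) (g : 'I_p -> R -> R)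
    (P : R -> R -> Prop) (r : R) (k : 'I_p) :
  (forall c, (\forall t \near +oo, P c t) \/ (\forall t \near +oo, ~ P c t)) ->
  (forall c t, r < t -> P c t -> exists k', g k' t = c) ->
  (forall t, r < t -> P (g k t) t) ->
  {in `]r, +oo[, continuous (g k)} ->
  forall a b, a < b ->
    (\forall t \near +oo, a <= g k t) \/ (\forall t \near +oo, g k t <= b).
Proof.
move=> Pdec Pval Pg gcont a b ab; apply: contrapT => /not_orP[].
move=> /frequently_pinfty Ha /frequently_pinfty Hb.
have Pc c : a <= c <= b -> \forall t \near +oo, P c t.
  move=> /andP[ac cb]; have [//|/(@eventually_pinfty_from _ _ r)[T rT HT]] := Pdec c.
  have [t1 Tt1 /negP] := Ha T; rewrite -ltNge => g1.
  have [t2 Tt2 /negP] := Hb T; rewrite -ltNge => g2.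
  have gc : {within `[Num.min t1 t2, Num.max t1 t2], continuous (g k)}.
    apply: continuous_in_subspaceT => t; rewrite inE/= in_itv/= => /andP[t12 _].
    apply: gcont; rewrite in_itv/= andbT; apply: le_lt_trans rT _.
    by apply: lt_le_trans t12; rewrite lt_min Tt1.
  (* the value crossed by [g k] is [c] at a radius where [P c] fails *)
  have := IVT (v := c) _ gc; case.
  - by rewrite ge_min !le_max !lexx.
  - have [_|_] := leP t1 t2.
      rewrite ge_min le_max (ltW (lt_le_trans g1 ac)).
      by rewrite (ltW (le_lt_trans cb g2)) orbT.
    rewrite ge_min le_max (ltW (lt_le_trans g1 ac)) orbT.
    by rewrite (ltW (le_lt_trans cb g2)).
  move=> t; rewrite in_itv/= => /andP[t12 _] gt; exfalso.
  have Tt : T < t by apply: lt_le_trans t12; rewrite lt_min Tt1.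
  by apply: (HT t Tt); rewrite -gt; apply: Pg; exact: le_lt_trans rT Tt.
have p0 : (0 < p%:R :> R) by rewrite ltr0n (leq_ltn_trans _ (ltn_ord k)).
pose c (j : 'I_p.+1) := a + (b - a) * (j%:R / p%:R).
have cab j : a <= c j <= b.
  have j0 : 0 <= j%:R / p%:R :> R by rewrite divr_ge0// ltW.
  have j1 : j%:R / p%:R <= 1 :> R.
    by rewrite ler_pdivrMr// mul1r ler_nat -ltnS.
  by rewrite /c; apply/andP; split; nra.
have /(@eventually_pinfty_from _ _ r)[T rT HT] :
  \forall t \near +oo, forall j, P (c j) t by apply: filter_forall => j; exact: Pc.
have tr : r < T + 1 by rewrite (le_lt_trans rT)// ltrDl.
have /choice[phi phiE] : forall j, exists k', g k' (T + 1) = c j.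
  by move=> j; apply: Pval => //; apply: HT; rewrite ltrDl.
have phi_inj : injective phi.
  move=> i j ij; have : c i = c j by rewrite -!phiE ij.
  move=> /addrI/mulfI; rewrite subr_eq0 gt_eqF// => /(_ isT).
  move=> /(mulIf (invr_neq0 (lt0r_neq0 p0)))/eqP.
  by rewrite eqr_nat => /eqP ij'; exact: val_inj.
by have := leq_card phi phi_inj; rewrite !card_ord ltnn.
Qed.

(** The limit is the supremum of the eventual lower bounds of [g]. *)
Lemma no_oscillation_cvg (R : realType) (g : R -> R) :
  (forall a b, a < b ->
    (\forall t \near +oo, a <= g t) \/ (\forall t \near +oo, g t <= b)) ->
  cvg ((g t)%:E @[t --> +oo]).
Proof.
move=> osc; pose Q := [set a | \forall t \near +oo, a <= g t].
have Qle a : ~ Q a -> forall b, a < b -> \forall t \near +oo, g t <= b.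
  by move=> nQa b /osc[].
have [Qne|Q0] := pselect (Q !=set0); last first.
  apply/cvg_ex; exists -oo%E; apply/cvgeNyPle => A.
  have : \forall t \near +oo, g t <= A.
    by apply: (Qle (A - 1)); [move=> ?; apply: Q0; exists (A - 1)|lra].
  by apply: filterS => t; rewrite lee_fin.
have [Qub|nQub] := pselect (has_ubound Q); last first.
  apply/cvg_ex; exists +oo%E; apply/cvgeyPge => A.
  have [a [Qa Aa]] : exists a, Q a /\ A < a.
    apply: contrapT => H; apply: nQub; exists A => a Qa.
    by rewrite leNgt; apply/negP => Aa; apply: H; exists a.
  by apply: filterS Qa => t ag; rewrite lee_fin; lra.
apply/cvg_ex; exists (sup Q)%:E; apply: cvg_EFin; first by near=> t.
apply/cvgrPdist_le => e e0.
have [a Qa ae] := sup_adherent e0 (conj Qne Qub).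
have Qb : \forall t \near +oo, g t <= sup Q + e.
  apply: (Qle (sup Q + e / 2)); last by lra.
  by move=> /(ub_le_sup Qub) ?; lra.
near=> t; have ag : a <= g t by near: t.
have gb : g t <= sup Q + e by near: t.
by rewrite /= ler_distlC; apply/andP; split; lra.
Unshelve. all: by end_near. Qed.

(** * Euclidean geometry, continuity and lower semicontinuity *)

Section dot_theory.
Variables (R : realType) (n : nat).
Implicit Types u v w : 'rV[R]_n.

Lemma dotC u v : dot u v = dot v u.
Proof. by apply: eq_bigr => i _; rewrite mulrC. Qed.

Lemma dotDl u v w : dot (u + v) w = dot u w + dot v w.
Proof. by rewrite /dot -big_split; apply: eq_bigr => i _; rewrite mxE mulrDl. Qed.

Lemma dotZl c u v : dot (c *: u) v = c * dot u v.
Proof. by rewrite /dot mulr_sumr; apply: eq_bigr => i _; rewrite mxE mulrA. Qed.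

Lemma dotNl u v : dot (- u) v = - dot u v.
Proof. by rewrite -scaleN1r dotZl mulN1r. Qed.

Lemma dotDr u v w : dot w (u + v) = dot w u + dot w v.
Proof. by rewrite dotC dotDl !(dotC w). Qed.

Lemma dotNr u v : dot u (- v) = - dot u v.
Proof. by rewrite dotC dotNl dotC. Qed.

Lemma dotZr c u v : dot u (c *: v) = c * dot u v.
Proof. by rewrite dotC dotZl dotC. Qed.

Definition dotE := (dotDl, dotDr, dotNl, dotNr, dotZl, dotZr).

Lemma dot_ge0 u : 0 <= dot u u.
Proof. by rewrite sumr_ge0// => i _; rewrite -expr2 sqr_ge0. Qed.

Lemma dot_eq0 u : dot u u = 0 -> u = 0.
Proof.
move=> /eqP; rewrite psumr_eq0 => [/allP u0|i _]; last by rewrite -expr2 sqr_ge0.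
apply/rowP => i; have /implyP/(_ isT) := u0 i (mem_index_enum i).
by rewrite mxE -expr2 sqrf_eq0 => /eqP.
Qed.

Lemma cauchy_schwarz u v : dot u v ^+ 2 <= dot u u * dot v v.
Proof.
have [v0|vn0] := eqVneq (dot v v) 0.
  by rewrite (dot_eq0 v0) -(scale0r v) !dotE !(mul0r, mulr0) expr2 mul0r.
have v_gt0 : 0 < dot v v by rewrite lt_neqAle eq_sym vn0 dot_ge0.
have := dot_ge0 (dot v v *: u - dot u v *: v).
rewrite !dotE (dotC v u) => H.
have : 0 <= dot v v * (dot u u * dot v v - dot u v ^+ 2) by nra.
by rewrite pmulr_rge0// subr_ge0.
Qed.

Lemma enorm_ge0 u : 0 <= enorm u.
Proof. exact: sqrtr_ge0. Qed.

Lemma sqr_enorm u : enorm u ^+ 2 = dot u u.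
Proof. by rewrite sqr_sqrtr// dot_ge0. Qed.

End dot_theory.

Section topology_rV.
Variables (R : realType) (T : Type).

Lemma cvg_rV (n : nat) (F : set_system T) {FF : Filter F} (u : T -> 'rV[R]_n)
    (l : 'rV[R]_n) :
  (forall i, u t 0 i @[t --> F] --> l 0 i) -> u t @[t --> F] --> l.
Proof.
move=> ul V [P Pl PV]; apply: (@filterS _ F _ [set t | forall i j, P i j (u t i j)]).
  by move=> t Pt; exact: PV.
apply: filter_forall => i; apply: filter_forall => j.
by rewrite ord1; apply: ul; rewrite -(ord1 i).
Qed.

Lemma cvg_pair_rv (n : nat) (F : set_system T) {FF : Filter F}
    (u : T -> 'rV[R]_n) (a : T -> R) (l : 'rV[R]_n) (b : R) :
  u t @[t --> F] --> l -> a t @[t --> F] --> b ->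
  pair_rv (u t) (a t) @[t --> F] --> pair_rv l b.
Proof.
move=> ul ab; apply: cvg_rV => i; rewrite mxE.
have E t : pair_rv (u t) (a t) 0 i =
    match fintype.split i with inl j => u t 0 j | inr _ => a t end.
  by rewrite mxE; case: fintype.split => // j; rewrite mxE.
rewrite (eq_cvg _ _ E); case: fintype.split => j; last by rewrite mxE.
exact: (cvg_comp _ _ ul (@coord_continuous _ _ _ 0 j l)).
Qed.

Lemma cvg_dot (n : nat) (F : set_system T) {FF : Filter F}
    (u v : T -> 'rV[R]_n) (l m : 'rV[R]_n) :
  u t @[t --> F] --> l -> v t @[t --> F] --> m ->
  dot (u t) (v t) @[t --> F] --> dot l m.
Proof.
move=> ul vm; apply: cvg_big => [|i _]; first exact: add_continuous.
apply: cvgM; last exact: (cvg_comp _ _ vm (@coord_continuous _ _ _ 0 i m)).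
exact: (cvg_comp _ _ ul (@coord_continuous _ _ _ 0 i l)).
Qed.

End topology_rV.

Section continuous_algebra.
Variables (R : realType) (T : topologicalType).

Lemma continuous_dot (n : nat) (u v : T -> 'rV[R]_n) :
  continuous u -> continuous v -> continuous (fun t => dot (u t) (v t)).
Proof. by move=> uc vc t; apply: cvg_dot; [exact: uc|exact: vc]. Qed.

Lemma continuous_sub (V : normedModType R) (u v : T -> V) :
  continuous u -> continuous v -> continuous (fun t => u t - v t).
Proof. by move=> uc vc t; apply: cvgB; [exact: uc|exact: vc]. Qed.

Lemma continuous_add (V : normedModType R) (u v : T -> V) :
  continuous u -> continuous v -> continuous (fun t => u t + v t).
Proof. by move=> uc vc t; apply: cvgD; [exact: uc|exact: vc]. Qed.

Lemma continuous_mul (u v : T -> R) :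
  continuous u -> continuous v -> continuous (fun t => u t * v t).
Proof. by move=> uc vc t; apply: cvgM; [exact: uc|exact: vc]. Qed.

Lemma continuous_scale (V : normedModType R) (u : T -> R) (v : T -> V) :
  continuous u -> continuous v -> continuous (fun t => u t *: v t).
Proof. by move=> uc vc t; apply: cvgZ; [exact: uc|exact: vc]. Qed.

Lemma continuous_opp (V : normedModType R) (u : T -> V) :
  continuous u -> continuous (fun t => - u t).
Proof. by move=> uc t; apply: cvgN; exact: uc. Qed.

Lemma continuous_abs (u : T -> R) :
  continuous u -> continuous (fun t => `|u t|).
Proof. by move=> uc t; apply: cvg_norm; exact: uc. Qed.

Lemma continuous_id : continuous (@id T).
Proof. by move=> t; exact: cvg_id. Qed.

Lemma continuous_pair_rv (n : nat) (u : T -> 'rV[R]_n) (a : T -> R) :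
  continuous u -> continuous a -> continuous (fun t => pair_rv (u t) (a t)).
Proof. by move=> uc ac t; apply: cvg_pair_rv; [exact: uc|exact: ac]. Qed.

End continuous_algebra.

Lemma continuous_enorm (R : realType) (n : nat) : continuous (@enorm R n).
Proof.
move=> x; apply: (@continuous_comp _ _ _ (fun x => dot x x)) => //; last first.
  exact: sqrt_continuous.
exact: (@cvg_dot _ _ _ (nbhs x) _ id id x x cvg_id cvg_id).
Qed.

Lemma dot_pair_rv (R : realType) (n : nat) (u v : 'rV[R]_n) (a b : R) :
  dot (pair_rv u a) (pair_rv v b) = dot u v + a * b.
Proof.
rewrite /dot big_split_ord big_ord1 /=; congr (_ + _).
  by apply: eq_bigr => i _; rewrite !row_mxEl.
by rewrite !row_mxEr !mxE.
Qed.

Lemma pair_rvB (R : realType) (n : nat) (u v : 'rV[R]_n) (a b : R) :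
  pair_rv u a - pair_rv v b = pair_rv (u - v) (a - b).
Proof.
rewrite /pair_rv opp_row_mx add_row_mx; congr row_mx.
by apply/matrixP => i j; rewrite !mxE.
Qed.

Lemma pair_rvZ (R : realType) (n : nat) (u : 'rV[R]_n) (c a : R) :
  c *: pair_rv u a = pair_rv (c *: u) (c * a).
Proof.
rewrite /pair_rv scale_row_mx; congr row_mx.
by apply/matrixP => i j; rewrite !mxE.
Qed.

Section lower_semicontinuity.
Variables (R : realType) (T : topologicalType).
Implicit Types F : T -> \bar R.

Lemma lsc_addc F (phi : T -> R) :
  lower_semicontinuous F -> continuous phi ->
  lower_semicontinuous (fun t => (F t + (phi t)%:E)%E).
Proof.
move=> Flsc phic x a aF.
have [b /andP[ab bF]] : exists b, (a - phi x < b) && (b%:E < F x)%E.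
  move: aF; case: (F x) => [c| |]//=; last first.
    by exists (a - phi x + 1); rewrite ltrDl ltr01 ltry.
  rewrite -EFinD lte_fin => ac; exists ((a - phi x + c) / 2).
  by rewrite lte_fin; apply/andP; split; lra.
have [V xV VF] := Flsc _ _ bF.
exists (V `&` [set y | a - b < phi y]).
  by apply: filterI => //; apply: (cvgr_gt (phi x) (phic x)); lra.
move=> y [/VF bFy /= aby]; move: bFy; case: (F y) => [d| |]//.
  by rewrite -EFinD !lte_fin => bd; lra.
by move=> _; rewrite addye ?ltry.
Qed.

Lemma lsc_comp (U : topologicalType) (g : U -> T) F :
  lower_semicontinuous F -> continuous g -> lower_semicontinuous (F \o g).
Proof.
move=> Flsc gc x a /Flsc[V xV VF]; exists (g @^-1` V) => [|y /VF//].
exact: gc.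
Qed.

(** The sublevel sets of [F] at points of [K] form a filter base on [K]; any
of its cluster points is a minimiser. *)
Lemma lsc_compact_min F (K : set T) :
  lower_semicontinuous F -> compact K -> K !=set0 ->
  exists2 c, K c & forall t, K t -> (F c <= F t)%E.
Proof.
move=> Flsc Kc [k0 Kk0].
pose B a := [set t | K t /\ (F t <= F a)%E].
have FF : ProperFilter (filter_from K B).
  apply: filter_from_proper => [|a Ka]; last by exists a; split.
  apply: filter_from_filter; first by exists k0.
  move=> a b Ka Kb; have [ab|ba] := leP (F a) (F b).
    by exists a => // t [Kt ta]; split; split=> //; exact: le_trans ab.
  by exists b => // t [Kt tb]; split; split=> //; exact: le_trans (ltW ba).
have [c [Kc' cc]] : K `&` cluster (filter_from K B) !=set0.
  by apply: Kc; exists k0 => // t [].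
exists c => // t Kt; rewrite leNgt; apply/negP => tc.
have [b /andP[tb bc]] : exists b, (F t <= b%:E)%E && (b%:E < F c)%E.
  move: tc; case: (F t) => [d| |]; case: (F c) => [e| |]// tc.
  - by exists d; rewrite lexx.
  - by exists d; rewrite lexx.
  - by exists (e - 1); rewrite leNye lte_fin gtrBl ltr01.
  - by exists 0; rewrite leNye ltry.
have [V cV VF] := Flsc _ _ bc.
have [s [[Ks st] /VF bs]] := cc (B t) V (ex_intro2 _ _ t Kt (fun=> id)) cV.
by move: (lt_le_trans bs (le_trans st tb)); rewrite ltxx.
Qed.

End lower_semicontinuity.

(** * Regular and limiting normals *)

(** Countable choice along balls of radius [1 / (k + 1)] recovers the
sequences. *)
Lemma limiting_normal_approx (R : realType) (n : nat) (S : set 'rV[R]_n)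
    (x v : 'rV[R]_n) :
  (forall U V, nbhs x U -> nbhs v V ->
    exists y w, [/\ S y, regular_normal S y w, U y & V w]) ->
  limiting_normal S x v.
Proof.
move=> H; pose b (k : nat) (z : 'rV[R]_n) := ball z k.+1%:R^-1.
have [yw ywP] : {yw : nat -> 'rV[R]_n * 'rV[R]_n & forall k,
    [/\ S (yw k).1, regular_normal S (yw k).1 (yw k).2,
        b k x (yw k).1 & b k v (yw k).2]}.
  apply: (@choice _ _ (fun k (yw : 'rV[R]_n * 'rV[R]_n) =>
    [/\ S yw.1, regular_normal S yw.1 yw.2, b k x yw.1 & b k v yw.2])) => k.
  have [||y [w ywk]] := H (b k x) (b k v); last by exists (y, w).
    by apply: nbhsx_ballx; rewrite invr_gt0.
  by apply: nbhsx_ballx; rewrite invr_gt0.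
have bcvg (z : 'rV[R]_n) (u : nat -> 'rV[R]_n) :
    (forall k, b k z (u k)) -> u @ \oo --> z.
  move=> bu; apply/cvg_ballP => e e0; near=> k.
  apply: le_ball (bu k); apply: ltW.
  by near: k; exact: (near_infty_natSinv_lt (PosNum e0)).
exists (fun k => (yw k).1), (fun k => (yw k).2); split.
- by move=> k; have [] := ywP k.
- by apply: bcvg => k; have [] := ywP k.
- by apply: bcvg => k; have [] := ywP k.
Unshelve. all: by end_near. Qed.

(** A quadratic bound is [o(enorm (y - x))]: all regular normals below are
obtained as these proximal normals. *)
Lemma proximal_regular_normal (R : realType) (n : nat) (S : set 'rV[R]_n)
    (x v : 'rV[R]_n) (c : R) :
  (\forall y \near x, S y -> dot v (y - x) <= c * dot (y - x) (y - x)) ->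
  regular_normal S x v.
Proof.
move=> H e e0.
have c0 : 0 < `|c| + 1 by rewrite ltr_wpDl.
have small : \forall y \near x, enorm (y - x) < e / (`|c| + 1).
  have xx : enorm (x - x) = 0.
    by rewrite /enorm subrr -(scale0r 0) dotZl mul0r sqrtr0.
  have yx : enorm (y - x) @[y --> x] --> enorm (x - x).
    apply: (@cvg_comp _ _ _ (fun y => y - x) (@enorm R n) _ (nbhs (x - x))).
      exact: (@cvgB _ _ _ (nbhs x) _ id (fun=> x) x x cvg_id (cvg_cst x)).
    exact: continuous_enorm.
  by apply: (cvgr_lt _ yx); rewrite xx divr_gt0.
near=> y => Sy; have yx0 := enorm_ge0 (y - x).
have Hy : dot v (y - x) <= c * dot (y - x) (y - x).
  by move: Sy; near: y.
have sy : (`|c| + 1) * enorm (y - x) < e.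
  by rewrite mulrC -ltr_pdivlMr//; near: y.
apply: le_trans Hy _; rewrite -sqr_enorm expr2 mulrA ler_wpM2r//.
apply: le_trans (ltW sy); rewrite ler_wpM2r//.
by rewrite (le_trans (ler_norm c))// lerDl.
Unshelve. all: by end_near. Qed.

Lemma regular_normalZ (R : realType) (n : nat) (S : set 'rV[R]_n)
    (x v : 'rV[R]_n) (c : R) : 0 < c ->
  regular_normal S x v -> regular_normal S x (c *: v).
Proof.
move=> c0 vN e e0; have := vN (e / c) (divr_gt0 e0 c0).
apply: filterS => y H Sy; have := H Sy.
by rewrite dotZl mulrAC ler_pdivlMr// mulrC.
Qed.

(** A quadratic minorant of [f] touching it at [x] makes [(v, -1)] a proximal
normal to the epigraph, since points above the graph only help. *)
Lemma regular_normal_epi (R : realType) (n : nat) (f : 'rV[R]_n -> \bar R)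
    (x v : 'rV[R]_n) (a c : R) :
  (\forall y \near x,
    ((a + dot v (y - x) - c * dot (y - x) (y - x))%:E <= f y)%E) ->
  regular_normal (epi f) (pair_rv x a) (pair_rv v (-1)).
Proof.
move=> H; apply: (@proximal_regular_normal _ _ _ _ _ `|c|).
have lc : lsubmx z @[z --> pair_rv x a] --> x.
  have {2}-> : x = lsubmx (pair_rv x a) by rewrite row_mxKl.
  apply: (@cvg_rV _ _ _ _ (nbhs_filter _)) => i; rewrite mxE.
  under eq_cvg do rewrite mxE.
  exact: coord_continuous.
have {}H : \forall z \near pair_rv x a, ((a + dot v (lsubmx z - x)
    - c * dot (lsubmx z - x) (lsubmx z - x))%:E <= f (lsubmx z))%E := lc _ H.
near=> z => -[y [b [zE yb]]].
have : ((a + dot v (lsubmx z - x)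
    - c * dot (lsubmx z - x) (lsubmx z - x))%:E <= f (lsubmx z))%E by near: z.
rewrite zE row_mxKl => /le_trans/(_ yb); rewrite lee_fin => Hz.
rewrite pair_rvB !dot_pair_rv.
have cd := ler_wpM2r (dot_ge0 (y - x)) (ler_norm c).
have := mulr_ge0 (normr_ge0 c) (sqr_ge0 (b - a)).
by rewrite expr2 mulrDr; lra.
Unshelve. all: by end_near. Qed.

Lemma compact_seq_cluster (T : topologicalType) (K : set T) (z : nat -> T) :
  compact K -> (forall k, K (z k)) ->
  exists2 x, K x & forall U N, nbhs x U -> exists2 k, (N <= k)%N & U (z k).
Proof.
move=> Kc Kz; have [x [Kx zx]] : K `&` cluster (z @ \oo) !=set0.
  by apply: Kc; exists 0%N => // k _; exact: Kz.
exists x => // U N xU.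
have zN : (z @ \oo) (z @` [set k | (N <= k)%N]).
  by exists N => // k Nk; exists k.
by have [_ [[k Nk <-] Uzk]] := zx _ U zN xU; exists k.
Qed.

(** * The fuzzy sum rule *)

Lemma compact_closed_ball (R : realType) (n : nat) (x : 'rV[R]_n) (e : R) :
  0 < e -> compact (closed_ball x e).
Proof.
move=> e0; apply: bounded_closed_compact; last exact: closed_ball_closed.
exists (`|x| + e); split; first exact: num_real.
move=> M eM y; rewrite closed_ballE//= /closed_ball_ /= => xy.
rewrite (le_trans _ (ltW eM))// -[y](subKr x) (le_trans (ler_normB _ _))//.
by rewrite lerD2l.
Qed.

Lemma compact_nbhs (R : realType) (n : nat) (x : 'rV[R]_n) (U : set 'rV[R]_n) :
  nbhs x U -> exists K, [/\ compact K, nbhs x K & K `<=` U].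
Proof.
move=> /nbhs_closedballP[e eU]; exists (closed_ball x e%:num); split=> //.
  exact: compact_closed_ball.
by apply/nbhs_closedballP; exists e.
Qed.

(** Second-order expansion at [x] of the squared distance to [z]. *)
Lemma dist_sqr_shift (R : realType) (n : nat) (x y z : 'rV[R]_n) :
  dot (y - z) (y - z) =
  dot (x - z) (x - z) + 2 * dot (x - z) (y - x) + dot (y - x) (y - x).
Proof.
have -> : y - z = (x - z) + (y - x) by rewrite [RHS]addrC addrA subrK.
by move: (x - z) (y - x) => u v; rewrite !dotE (dotC v u); ring.
Qed.

(** The constraint [x \in S] is decoupled: minimise over [x \in K] and
[y \in K `&` S], for a compact neighbourhood [K] of [x0], the function
[F x + j * |x - y|^2] where [F x = f x - dot p (x - x0) + (c + 1) * |x - x0|^2].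
The constant [c + 1], instead of [c], makes [x0] a strict minimiser of [F] on
[S], which forces the minimisers to cluster at [(x0, x0)]. *)
Lemma fuzzy_sum_rule (R : realType) (n : nat) (f : 'rV[R]_n -> \bar R)
    (S : set 'rV[R]_n) (x0 p : 'rV[R]_n) (a0 c e : R) (U : set 'rV[R]_n) :
  (forall x, (-oo < f x)%E) -> lower_semicontinuous f -> closed S ->
  S x0 -> f x0 = a0%:E ->
  (\forall x \near x0, S x ->
    ((a0 + dot p (x - x0) - c * dot (x - x0) (x - x0))%:E <= f x)%E) ->
  0 < e -> nbhs x0 U ->
  exists x y w a, [/\ U x, U y, f x = a%:E & `|a0 - a| < e] /\
    [/\ S y, regular_normal S y w & regular_normal (epi f) (pair_rv x a)
      (pair_rv (p - (2 * (c + 1)) *: (x - x0) - w) (-1))].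
Proof.
move=> f_ninfty f_lsc S_closed Sx0 fx0 support e0 x0U.
have [K [Kc x0K KS]] := compact_nbhs support.
have Kx0 : K x0 := nbhs_singleton x0K.
pose sq (x : 'rV[R]_n) := dot x x.
pose phi x := (c + 1) * sq (x - x0) - dot p (x - x0).
have sqBc (T : topologicalType) (u v : T -> 'rV[R]_n) : continuous u ->
    continuous v -> continuous (fun t => sq (u t - v t)).
  by move=> uc vc; apply: continuous_dot; exact: continuous_sub.
have x0c := @cst_continuous 'rV[R]_n _ x0.
have phic : continuous phi.
  apply: continuous_sub.
    apply: continuous_mul; first exact: cst_continuous.
    exact: sqBc (@continuous_id _) x0c.
  apply: continuous_dot; first exact: cst_continuous.
  exact: continuous_sub (@continuous_id _) x0c.
have phi0 : phi x0 = 0 by rewrite /phi /sq subrr -(scale0r 0) !dotE; ring.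
pose F x := (f x + (phi x)%:E)%E.
have F_lsc : lower_semicontinuous F by exact: lsc_addc.
have F_grow x : K x -> S x -> ((a0 + sq (x - x0))%:E <= F x)%E.
  move=> Kx Sx; have := KS x Kx Sx; rewrite /F /phi.
  case: (f x) (f_ninfty x) => [b| |]// _; last by move=> _; rewrite addye ?leey.
  by rewrite -EFinD !lee_fin -/(sq _); lra.
have Fx0 : F x0 = a0%:E by rewrite /F fx0 phi0 adde0.
have [m Km Fm] := lsc_compact_min F_lsc Kc (ex_intro K x0 Kx0).
have [B FB] : exists B, F m = B%:E.
  move: (Fm x0 Kx0); rewrite Fx0 /F.
  case: (f m) (f_ninfty m) => [b| |]// _ _.
  by exists (b + phi m).
pose pen (j : nat) (z : 'rV[R]_n * 'rV[R]_n) := 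
  (F z.1 + (j%:R * sq (z.1 - z.2))%:E)%E.
have pen_lsc j : lower_semicontinuous (pen j).
  apply: lsc_addc; first by apply: (@lsc_comp _ _ _ fst) => // z; exact: cvg_fst.
  apply: continuous_mul; first exact: cst_continuous.
  by apply: sqBc => t; [exact: cvg_fst|exact: cvg_snd].
pose KK := K `*` (K `&` S).
have KKc : compact KK.
  apply: compact_setX => //; rewrite setIC.
  apply: (subclosed_compact _ Kc); last exact: subIsetr.
  by apply: closedI => //; apply: compact_closed Kc; exact: norm_hausdorff.
have KK0 : KK (x0, x0) by split.
have /choice[z zP] j : exists z, KK z /\ forall t, KK t -> (pen j z <= pen j t)%E.
  by have [z] := lsc_compact_min (@pen_lsc j) KKc (ex_intro KK _ KK0); exists z.
have pen0 j : (pen j (z j) <= a0%:E)%E.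
  apply: le_trans ((zP j).2 _ KK0) _.
  by rewrite /pen /= Fx0 /sq subrr -(scale0r 0) !dotE mul0r mulr0 adde0.
have zF j : exists b, [/\ F (z j).1 = b%:E, B <= b &
    b + j%:R * sq ((z j).1 - (z j).2) <= a0].
  have [[Kzj _] _] := zP j; have := pen0 j; have := Fm _ Kzj; rewrite FB /pen.
  case: (F (z j).1) => [b| |]//; rewrite -EFinD !lee_fin => Bb ba.
  by exists b.
have [[x y] [/= Kx [Ky Sy]] clus] := compact_seq_cluster KKc (fun j => (zP j).1).
(* [j * |x - y|^2 <= a0 - B] at the minimisers, while [j] is unbounded *)
have xy : x = y.
  apply/eqP; rewrite -subr_eq0; apply/eqP/dot_eq0.
  apply/eqP; rewrite eq_le dot_ge0 andbT leNgt; apply/negP => d0.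
  set d := dot (x - y) (x - y) in d0.
  have aB : 0 <= (a0 - B) / (d / 2).
    have [b [_ Bb ba]] := zF 0%N; rewrite mul0r addr0 in ba.
    by rewrite divr_ge0// ?divr_ge0//; lra.
  have dist_c : continuous (fun t : 'rV[R]_n * 'rV[R]_n => sq (t.1 - t.2)).
    by apply: sqBc => t; [exact: cvg_fst|exact: cvg_snd].
  have near_d : \forall t \near (x, y), d / 2 < sq (t.1 - t.2).
    by apply: (cvgr_gt _ (dist_c (x, y))); rewrite /= /sq -/d; lra.
  have [k Nk dk] := clus _ (Num.bound ((a0 - B) / (d / 2))) near_d.
  have [b [_ Bb ba]] := zF k.
  have kd : a0 - B < k%:R * (d / 2).
    have := archi_boundP aB; rewrite ltr_pdivrMr ?divr_gt0// => /lt_le_trans; apply.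
    by rewrite ler_wpM2r ?ler_nat// divr_ge0// ltW.
  have := ler_wpM2l (ler0n R k) (ltW dk); lra.
(* [F <= a0] at the minimisers, whereas [F > a0] on [S] away from [x0] *)
subst y; have xx0 : x = x0.
  apply/eqP; rewrite -subr_eq0; apply/eqP/dot_eq0.
  apply/eqP; rewrite eq_le dot_ge0 andbT leNgt; apply/negP => d0.
  have aFx : (a0%:E < F x)%E.
    by apply: lt_le_trans (F_grow x Kx Sy); rewrite lte_fin ltrDl.
  have [V xV VF] := F_lsc _ _ aFx.
  have [k _ Vk] := clus (fst @^-1` V) 0%N (cvg_fst xV).
  have [b [Fb _ ba]] := zF k; have := VF _ Vk; rewrite Fb lte_fin.
  have := mulr_ge0 (ler0n R k) (dot_ge0 ((z k).1 - (z k).2)).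
  by rewrite -/(sq _); lra.
subst x; pose W := [set x | [/\ U x, nbhs x K, - e < phi x & ((a0 - e)%:E < f x)%E]].
have x0W : nbhs x0 W.
  have [V x0V VF] : exists2 V, nbhs x0 V & forall x, V x -> ((a0 - e)%:E < f x)%E.
    by apply: f_lsc; rewrite fx0 lte_fin; lra.
  have phie : \forall x \near x0, - e < phi x.
    by apply: (cvgr_gt _ (phic x0)); rewrite phi0; lra.
  near=> x; split; near: x => //.
  - exact: nbhs_interior.
  - by apply: filterS x0V.
have x0WW : nbhs (x0, x0) (W `*` W) by exists (W, W).
have [k _] := clus _ 0%N x0WW.
have [b [Fb _ ba]] := zF k; have [[Kxk [Kyk Syk]] zmin] := zP k.
move: Fb ba Kxk Kyk Syk zmin; case: (z k) => [x y] /= Fb ba Kx' Ky' Sy' zmin.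
move=> [[/= Ux xK phix fx] [/= Uy yK _ _]].
have [a fa ab] : exists2 a, f x = a%:E & a + phi x = b.
  move: Fb; rewrite /F; case: (f x) => [a| |]// [ab].
  by exists a.
have sqC u v : sq (u - v) = sq (v - u) by rewrite /sq -opprB dotNl dotNr opprK.
have k0 : 0 <= k%:R * sq (x - y) by rewrite mulr_ge0// dot_ge0.
exists x, y, ((2 * k%:R) *: (x - y)), a; split; split=> //.
- by rewrite ltr_norml; rewrite fa lte_fin in fx; apply/andP; split; lra.
- apply: (@proximal_regular_normal _ _ _ _ _ k%:R); near=> y' => Sy''.
  have Ky'' : K y' by near: y'.
  have := zmin (x, y') (conj Kx' (conj Ky'' Sy'')).
  rewrite /pen /= Fb -!EFinD lee_fin !(sqC x) /sq (dist_sqr_shift y y' x).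
  by rewrite dotZl -[x - y]opprB dotNl; nra.
- apply: (@regular_normal_epi _ _ _ _ _ _ (c + 1 + k%:R)); near=> x'.
  have Kx'' : K x' by near: x'.
  have := zmin (x', y) (conj Kx'' (conj Ky' Sy')).
  rewrite /pen /= Fb /F; case: (f x') (f_ninfty x') => [a'| |]// _; last first.
    by move=> _; rewrite leey.
  rewrite -!EFinD !lee_fin -ab /phi /sq (dist_sqr_shift x x' x0).
  rewrite (dist_sqr_shift x x' y).
  have -> : dot p (x' - x0) = dot p (x - x0) + dot p (x' - x).
    by rewrite -dotDr; congr dot; rewrite [RHS]addrC addrA subrK.
  have dotB u v w d : dot (u - v - w) d = dot u d - dot v d - dot w d.
    by move: d => d'; rewrite !dotDl !dotNl.
  by rewrite dotB !dotZl; lra.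
Unshelve. all: by end_near. Qed.

(** * The limiting sum rule *)

Lemma limiting_normalZ (R : realType) (n : nat) (S : set 'rV[R]_n)
    (x v : 'rV[R]_n) (c : R) : 0 < c ->
  limiting_normal S x v -> limiting_normal S x (c *: v).
Proof.
move=> c0 [xs [vs [Sv xsx vsv]]]; exists xs, (fun k => c *: vs k); split=> //.
  by move=> k; have [Sk vk] := Sv k; split=> //; exact: regular_normalZ.
exact: cvgZ (cvg_cst c) vsv.
Qed.

(** The approximate normals [w k] of the fuzzy rule may be unbounded, so the
pairs [(w k, 1)] are rescaled by [s k = 1 / (1 + |w k|)] and a cluster point
[(v, q)] is taken on the compact set [|v| + q = 1]. If [q > 0], dividing by
[q] gives the decomposition; if [q = 0], then [v] is nonzero and contradicts
the qualification condition. *)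
Lemma sum_rule (R : realType) (n : nat) (f : 'rV[R]_n -> \bar R)
    (S : set 'rV[R]_n) (x0 p : 'rV[R]_n) (a0 c : R) :
  (forall x, (-oo < f x)%E) -> lower_semicontinuous f -> closed S ->
  S x0 -> f x0 = a0%:E ->
  (\forall x \near x0, S x ->
    ((a0 + dot p (x - x0) - c * dot (x - x0) (x - x0))%:E <= f x)%E) ->
  singular_subdiff f x0 `&` [set - w | w in limiting_normal S x0] = [set 0] ->
  exists v w, [/\ subdiff f x0 v, limiting_normal S x0 w & p = v + w].
Proof.
move=> f_ninfty f_lsc S_closed Sx0 fx0 support qc.
pose C := 2 * (c + 1); pose b (k : nat) : R := k.+1%:R^-1.
have b0 k : 0 < b k by rewrite invr_gt0.
have /choice[t tP] k : exists t : 'rV[R]_n * 'rV[R]_n * 'rV[R]_n * R,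
    let: (x, y, w, a) := t in
    [/\ ball x0 (b k) x, ball x0 (b k) y, f x = a%:E & ball a0 (b k) a] /\
    [/\ S y, regular_normal S y w &
      regular_normal (epi f) (pair_rv x a) (pair_rv (p - C *: (x - x0) - w) (-1))].
  have [x [y [w [a H]]]] := fuzzy_sum_rule f_ninfty f_lsc S_closed Sx0 fx0
    support (b0 k) (nbhsx_ballx x0 _ (b0 k)).
  by exists (x, y, w, a).
pose x k := (t k).1.1.1; pose y k := (t k).1.1.2.
pose w k := (t k).1.2; pose a k := (t k).2.
have {tP} tP k : [/\ ball x0 (b k) (x k), ball x0 (b k) (y k), f (x k) = (a k)%:E
    & ball a0 (b k) (a k)] /\ [/\ S (y k), regular_normal S (y k) (w k) &
    regular_normal (epi f) (pair_rv (x k) (a k))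
      (pair_rv (p - C *: (x k - x0) - w k) (-1))].
  by rewrite /x /y /w /a; have := tP k; case: (t k) => [[[]]].
have b_cvg (T : pseudoMetricType R) (l : T) (z : nat -> T) :
    (forall k, ball l (b k) (z k)) -> z @ \oo --> l.
  move=> bz; apply/cvg_ballP => e e0; near=> k.
  apply: le_ball (bz k); apply: ltW.
  by near: k; exact: (near_infty_natSinv_lt (PosNum e0)).
have x_cvg : x @ \oo --> x0 by apply: b_cvg => k; have [[]] := tP k.
have y_cvg : y @ \oo --> x0 by apply: b_cvg => k; have [[]] := tP k.
have a_cvg : a @ \oo --> a0 by apply: b_cvg => k; have [[]] := tP k.
pose s k := (1 + `|w k|)^-1; pose u k := s k *: w k.
have s0 k : 0 < s k by rewrite invr_gt0 ltr_wpDr.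
pose K := [set z : 'rV[R]_n * R | `|z.1| + z.2 = 1 /\ 0 <= z.2].
have K_compact : compact K.
  apply: (@subclosed_compact _ _
    (closed_ball (0 : 'rV[R]_n) (1 : R) `*` `[(0 : R), 1]%classic)).
  - rewrite /K; apply: (@closedI _ [set z : 'rV[R]_n * R | `|z.1| + z.2 = 1]
      [set z : 'rV[R]_n * R | 0 <= z.2]).
      apply: (closed_comp (f := fun z : 'rV[R]_n * R => `|z.1| + z.2) _ (@closed_eq R 1)).
      move=> z _; apply: cvgD; last exact: cvg_snd.
      by apply: cvg_norm; exact: cvg_fst.
    apply: (closed_comp _ (@closed_ge R 0)) => z _; exact: cvg_snd.
  - apply: compact_setX; last exact: segment_compact.
    exact: compact_closed_ball.
  - move=> z [z1 z2]; split; last by rewrite /= in_itv/= z2 -z1 lerDr /=.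
    rewrite closed_ballE//= /closed_ball_ /= sub0r normrN; lra.
have K_us k : K (u k, s k).
  split=> /=; last exact: ltW.
  rewrite normrZ gtr0_norm// -[X in _ + X]mulr1 -mulrDr addrC.
  by rewrite mulVf// gt_eqF// ltr_wpDr.
have [[v q] /= [vq q0] clus] := compact_seq_cluster K_compact K_us.
have Nv : limiting_normal S x0 v.
  apply: limiting_normal_approx => U V x0U vV.
  have [N _ NU] := y_cvg _ x0U.
  have [k Nk Vk] := clus (fst @^-1` V) N (cvg_fst vV).
  have [_ [Sy wy _]] := tP k; exists (y k), (u k); split=> //.
  - exact: regular_normalZ.
  - exact: NU.
have Nepi : limiting_normal (epi f) (pair_rv x0 a0) (pair_rv (q *: p - v) (- q)).
  apply: limiting_normal_approx => U V x0U vV.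
  have [N _ NU] := cvg_pair_rv x_cvg a_cvg x0U.
  pose Phi (z : ('rV[R]_n * R) * 'rV[R]_n) :=
    pair_rv (z.1.2 *: (p - C *: (z.2 - x0)) - z.1.1) (- z.1.2).
  have Phi_c : continuous Phi.
    apply: continuous_pair_rv.
      apply: continuous_sub; last by move=> z; apply: (cvg_comp _ _ cvg_fst); exact: cvg_fst.
      apply: continuous_scale.
        by move=> z; apply: (cvg_comp _ _ cvg_fst); exact: cvg_snd.
      apply: continuous_sub; first exact: cst_continuous.
      apply: continuous_scale; first exact: cst_continuous.
      by apply: continuous_sub; [move=> z; exact: cvg_snd|exact: cst_continuous].
    apply: continuous_opp => z.
    by apply: (cvg_comp _ _ cvg_fst); exact: cvg_snd.
  have PhiV : nbhs (v, q, x0) (Phi @^-1` V).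
    apply: Phi_c; rewrite /Phi /= subrr scaler0 subr0; exact: vV.
  have [[A B] /= [vA xB] AB] := PhiV.
  have [M _ MB] := x_cvg _ xB.
  have [k Nk Ak] := clus A (maxn N M) vA.
  have [[_ _ fx _] [_ _ wx]] := tP k.
  exists (pair_rv (x k) (a k)), (s k *: pair_rv (p - C *: (x k - x0) - w k) (-1)).
  split.
  - by exists (x k), (a k); rewrite fx.
  - exact: regular_normalZ.
  - by apply: NU => /=; apply: leq_trans Nk; rewrite leq_maxl.
  - rewrite pair_rvZ scalerBr mulrN1; apply: (AB ((u k, s k), x k)); split=> //=.
    by apply: MB => /=; apply: leq_trans Nk; rewrite leq_maxr.
have [q_eq0|qn0] := eqVneq q 0.
  have v0 : v = 0.
    have : (singular_subdiff f x0 `&` [set - w | w in limiting_normal S x0]) (- v).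
      split; last by exists v.
      rewrite /singular_subdiff /= fx0 /=.
      by move: Nepi; rewrite q_eq0 scale0r sub0r oppr0.
    by rewrite qc /= => /eqP; rewrite oppr_eq0 => /eqP.
  by move: vq; rewrite q_eq0 v0 normr0 addr0 => /esym/eqP; rewrite oner_eq0.
have {}q0 : 0 < q by rewrite lt_neqAle eq_sym qn0.
exists (p - q^-1 *: v), (q^-1 *: v); split; last by rewrite subrK.
  have := limiting_normalZ (divr_gt0 ltr01 q0) Nepi.
  rewrite /subdiff /= fx0 /= pair_rvZ mul1r scalerBr scalerA mulVf// scale1r.
  by rewrite mulrN mulVf.
by apply: limiting_normalZ => //; rewrite invr_gt0.
Unshelve. all: by end_near. Qed.

(** * Tangency points below a given point *)

Lemma norm_le_enorm (R : realType) (n : nat) (x : 'rV[R]_n) : `|x| <= enorm x.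
Proof.
rewrite [leLHS]/Num.norm /= mx_normrE; apply/bigmax_leP; split=> [|[i j] _ /=].
  exact: enorm_ge0.
rewrite -(ler_sqr (x := `|_|)) ?nnegrE ?enorm_ge0// sqr_enorm ord1.
rewrite real_normK ?num_real// /dot (bigD1 j)//= expr2 lerDl.
by rewrite sumr_ge0// => k _; rewrite -expr2 sqr_ge0.
Qed.

Lemma enorm_bounded_compact (R : realType) (n : nat) (A : set 'rV[R]_n) (r : R) :
  closed A -> (forall x, A x -> enorm x <= r) -> compact A.
Proof.
move=> Acl Ar; apply: bounded_closed_compact => //; exists r.
split; first exact: num_real.
move=> M rM x Ax; apply: le_trans (ltW rM).
exact: le_trans (norm_le_enorm x) (Ar x Ax).
Qed.

Lemma lsc_bounded_below_compact (R : realType) (T : topologicalType)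
    (f : T -> \bar R) (K : set T) :
  (forall x, (-oo < f x)%E) -> lower_semicontinuous f -> compact K ->
  exists B : R, forall x, K x -> (B%:E <= f x)%E.
Proof.
move=> f_ninfty f_lsc Kc; have [K0|nK0] := pselect (K !=set0); last first.
  by exists 0 => x Kx; case: nK0; exists x.
have [m Km fm] := lsc_compact_min f_lsc Kc K0.
case fmE : (f m) (f_ninfty m) => [b| |]// _.
  by exists b => x /fm; rewrite fmE.
by exists 0 => x /fm; rewrite fmE leye_eq => /eqP ->; exact: leey.
Qed.

(** The penalty [K * q x ^+ 2], with [q x = |x|^2 - |x1|^2], replaces the
constraint that [x] be on the sphere through [x1]; its gradient at [x0] is
[(4 * K * q x0) *: x0], which supplies the multiplier of [x0] in the
definition of the tangency variety. *)
Lemma tangency_below (R : realType) (n : nat) (f : 'rV[R]_n -> \bar R)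
    (S : set 'rV[R]_n) (x1 : 'rV[R]_n) (T : R) :
  (forall x, (-oo < f x)%E) -> lower_semicontinuous f -> closed S ->
  (forall x, ((edom f `&` S) `\` eball T) x ->
    singular_subdiff f x `&` [set - w | w in limiting_normal S x] = [set 0]) ->
  0 < T -> edom f x1 -> S x1 -> T < enorm x1 ->
  exists x, [/\ tangency f S x, T < enorm x & (f x <= f x1)%E].
Proof.
move=> f_ninfty f_lsc S_closed qc T0 domx1 Sx1 Tx1.
pose c := dot x1 x1; pose q (x : 'rV[R]_n) := dot x x - c.
pose delta := (c - T ^+ 2) / 2.
have delta0 : 0 < delta.
  by rewrite divr_gt0// subr_gt0 /c -sqr_enorm ltr_sqr ?nnegrE ?enorm_ge0 ?ltW.
have q_cont : continuous q.
  apply: continuous_sub; last exact: cst_continuous.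
  by apply: continuous_dot; exact: continuous_id.
pose A := S `&` [set x | `|q x| <= delta].
have A_compact : compact A.
  apply: (@enorm_bounded_compact _ _ _ (Num.sqrt (c + delta))).
    apply: closedI => //; apply: (closed_comp _ (@closed_le R delta)) => x _.
    exact: continuous_abs.
  move=> x [_ /=]; rewrite ler_norml => /andP[_ qx].
  by rewrite ler_wsqrtr// -lerBlDl.
have q1 : q x1 = 0 by rewrite /q subrr.
have Ax1 : A x1 by split=> //=; rewrite q1 normr0 ltW.
have [b1 fx1] : exists b1, f x1 = b1%:E.
  move: domx1; rewrite /edom /=; case: (f x1) (f_ninfty x1) => [b| |]// _ _.
  by exists b.
have [B fB] := lsc_bounded_below_compact f_ninfty f_lsc A_compact.
have Bb1 : B <= b1 by have := fB _ Ax1; rewrite fx1.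
(* at the boundary of the annulus the penalty alone exceeds [b1 - B] *)
pose K := (b1 - B + 1) / delta ^+ 2.
have K0 : 0 < K by rewrite divr_gt0 ?exprn_gt0//; lra.
have Kdelta : b1 - B < K * delta ^+ 2.
  by rewrite divfK ?ltrDl// expf_neq0 ?gt_eqF.
pose G x := (f x + (K * q x ^+ 2)%:E)%E.
have G_lsc : lower_semicontinuous G.
  apply: lsc_addc => //; apply: continuous_mul; first exact: cst_continuous.
  exact: continuous_mul.
have [x0 [Sx0 Ax0] G0] := lsc_compact_min G_lsc A_compact (ex_intro A x1 Ax1).
have := G0 _ Ax1; have := fB _ (conj Sx0 Ax0).
rewrite {2}/G q1 expr0n /= mulr0 adde0 fx1 {1}/G.
case fx0 : (f x0) (f_ninfty x0) => [a0| |]// _.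
rewrite -EFinD !lee_fin => Ba0 a0b1.
have q0delta : `|q x0| < delta.
  have : `|q x0| ^+ 2 < delta ^+ 2.
    by rewrite real_normK ?num_real// -(ltr_pM2l K0); lra.
  by rewrite ltr_sqr ?nnegrE ?(ltW delta0).
have Tx0 : T < enorm x0.
  rewrite -ltr_sqr ?nnegrE ?enorm_ge0 ?(ltW T0)// sqr_enorm.
  move: q0delta delta0; rewrite ltr_norml /q /delta => /andP[q0delta _] delta0.
  lra.
pose D := dot (x0 + x0) (x0 + x0) + 1.
pose p := (- (4 * K * q x0)) *: x0.
pose C := 2 * K * `|q x0| + K * D.
have support : \forall x \near x0, S x ->
    ((a0 + dot p (x - x0) - C * dot (x - x0) (x - x0))%:E <= f x)%E.
  have near_delta : \forall x \near x0, `|q x| < delta.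
    by apply: (cvgr_lt _ (continuous_abs q_cont (x := x0))).
  have near_D : \forall x \near x0, dot (x + x0) (x + x0) < D.
    have shift_c : continuous (fun x : 'rV[R]_n => x + x0).
      exact: continuous_add (@continuous_id _) (@cst_continuous _ _ _).
    by apply: (cvgr_lt _ (continuous_dot shift_c shift_c (x := x0))); rewrite ltrDl.
  near=> x => Sx.
  have Ax : A x by split=> //=; apply: ltW; near: x.
  have xD : dot (x + x0) (x + x0) < D by near: x.
  have := G0 x Ax; rewrite /G fx0.
  case: (f x) (f_ninfty x) => [b| |]// _; last by move=> _; rewrite leey.
  rewrite -!EFinD !lee_fin.
  set d := x - x0; pose g := dot d (x + x0).
  have qg : q x = q x0 + g.
    by rewrite /q /g /d !dotE (dotC x0 x); ring.
  have gE : g = 2 * dot x0 d + dot d d.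
    by rewrite /g /d !dotE (dotC x0 x); ring.
  (* the quartic part of the penalty is at most quadratic near [x0] *)
  have gd : g ^+ 2 <= dot d d * D.
    apply: le_trans (cauchy_schwarz d (x + x0)) _.
    by rewrite ler_wpM2l ?dot_ge0// ltW.
  have Kgd : K * g ^+ 2 <= K * (dot d d * D) by rewrite ler_wpM2l// ltW.
  have Kqd : K * (q x0 * dot d d) <= K * (`|q x0| * dot d d).
    by rewrite ler_wpM2l ?(ltW K0)// ler_wpM2r ?dot_ge0// ler_norm.
  rewrite qg /p /C dotZl; move: Kgd Kqd; rewrite gE; lra.
have x0qc : ((edom f `&` S) `\` eball T) x0.
  split; first by split=> //; rewrite /edom /= fx0 ltry.
  by rewrite /eball /=; apply/negP; rewrite -ltNge.
have [v [w [vf wS pvw]]] :=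
  sum_rule f_ninfty f_lsc S_closed Sx0 fx0 support (qc x0 x0qc).
exists x0; split=> //; last first.
  by rewrite fx0 lee_fin; have := mulr_ge0 (ltW K0) (sqr_ge0 (q x0)); lra.
split=> //; first by case: x0qc => [[]].
exists (4 * K * q x0), v, w; split=> //.
by rewrite -pvw /p scaleNr addNr.
Unshelve. all: by end_near. Qed.

(** * The pieces at infinity *)

Section decomposition.
Variables (R : realType) (n l m p : nat) (f : 'rV[R]_n -> \bar R).
Variables (S : set 'rV[R]_n) (r : R) (C : 'I_l -> set 'rV[R]_n).
Variables (F : 'I_l -> set 'rV[R]_m) (h : 'rV[R]_m * R -> 'rV[R]_n).
Variables (Gam : 'I_p -> set 'rV[R]_n) (fk : 'I_p -> R -> R).
Hypothesis dec : decomposition_at_infinity f S r C F h Gam.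
Hypothesis fkP : forall k, radial_value f r (Gam k) (fk k).

Lemma piece_cover i x : C i x -> r < enorm x -> exists k, Gam k x.
Proof.
move=> Cx rx; have : (h @` (F i `*` `]r, +oo[)) x.
  rewrite (dec_C dec); split=> //.
  by rewrite /eball /=; apply/negP; rewrite -ltNge.
move=> [[a t] /= [Fa rt] <-].
have [k _ kE] : (range Gam) (h @` (connected_component (F i) a `*` `]r, +oo[)).
  by rewrite (dec_Gam dec); exists i, a.
exists k; rewrite kE; exists (a, t) => //; split=> //=.
exact: connected_component_refl.
Qed.

Lemma tangency_radial_value x : tangency f S x -> r < enorm x ->
  exists k, f x = (fk k (enorm x))%:E.
Proof.
move=> tx rx; have [[/esym tanE _ _]] := dec_partition dec.
have [i _ Cx] : cover [set: 'I_l] C x by rewrite -tanE.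
by have [k Gx] := piece_cover Cx rx; exists k; exact: fkP.
Qed.

(** The trivialisation provides, in each piece, a curve parametrised by the
radius, along which [f] coincides with the radial value. *)
Lemma piece_curve k : exists i (a : 'rV[R]_m), F i a /\
  forall t, r < t -> [/\ C i (h (a, t)), Gam k (h (a, t)) & enorm (h (a, t)) = t].
Proof.
have : (range Gam) (Gam k) by exists k.
rewrite (dec_Gam dec) => -[i [a [Fa GE]]]; exists i, a; split=> // t rt.
have tI : `]r, +oo[%classic t by rewrite /= in_itv/= rt.
split.
- suff : (h @` (F i `*` `]r, +oo[)) (h (a, t)) by rewrite (dec_C dec) => -[].
  by exists (a, t).
- rewrite GE; exists (a, t) => //; split=> //=.
  exact: connected_component_refl.
- by apply: (dec_norm dec) => //; exists i.
Qed.

Lemma radial_value_curve k i (a : 'rV[R]_m) t :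
  (forall t, r < t -> [/\ C i (h (a, t)), Gam k (h (a, t)) & enorm (h (a, t)) = t]) ->
  r < t -> f (h (a, t)) = (fk k t)%:E.
Proof. by move=> H rt; have [_ Gt nt] := H t rt; exact: fkP. Qed.

Lemma radial_value_continuous k : {in `]r, +oo[, continuous (fk k)}.
Proof.
have [i [a [Fa H]]] := piece_curve k.
move=> t0; rewrite in_itv/= andbT => rt0.
have near_r : \forall t \near t0, r < t by exact: lt_nbhsr.
have [_ hc _ _] := dec_homeo dec.
have h_cvg : h (a, t) @[t --> t0] --> h (a, t0).
  have D0 : ((\bigcup_i F i) `*` `]r, +oo[%classic) (a, t0).
    by split=> /=; [exists i|rewrite in_itv/= rt0].
  apply: cvg_trans; last exact: ((subspace_continuousP _ _).1 hc _ D0).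
  move=> P [[U V] /= [aU t0V] UV]; change (\forall t \near t0, P (h (a, t))).
  near=> t; have rt : r < t by near: t.
  apply: (UV (a, t)); split=> /=; first exact: nbhs_singleton.
  - by near: t.
  - by exists i.
  - by rewrite in_itv/= rt.
have f_cvg : f (h (a, t)) @[t --> t0] --> f (h (a, t0)).
  have [C0 _ _] := H t0 rt0.
  have fc := (subspace_continuousP _ _).1 (dec_C_cont dec (i := i)) _ C0.
  move=> P fP; have Pnear : \forall t \near t0, C i (h (a, t)) -> P (f (h (a, t))).
    exact: h_cvg (fc P fP).
  change (\forall t \near t0, P (f (h (a, t)))).
  near=> t; have rt : r < t by near: t.
  have [Ct _ _] := H t rt.
  have CP : C i (h (a, t)) -> P (f (h (a, t))) by near: t.
  exact: CP.
rewrite (radial_value_curve H rt0) in f_cvg.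
suff : (fk k t)%:E @[t --> t0] --> (fk k t0)%:E by move/fine_cvg.
apply: cvg_trans f_cvg; apply: near_eq_cvg; near=> t.
by rewrite (radial_value_curve H)//; near: t.
Unshelve. all: by end_near. Qed.

(** At a radius [t], the values of [f] on [C i] are among the [p] numbers
[fk k' t], since the pieces cover [C i]. *)
Lemma radial_value_cvg k : semialgebraic_fun f ->
  cvg ((fk k t)%:E @[t --> +oo]).
Proof.
move=> fsa; have [i [a [Fa H]]] := piece_curve k.
pose P c t := exists2 x, C i x & enorm x = t /\ f x = c%:E.
apply: no_oscillation_cvg; apply: (@no_oscillation _ _ _ P r).
- by move=> c; exact: level_eventually fsa (dec_C_semialg dec i).
- move=> c t rt [x Cx [xt fx]].
  have [k' Gx] : exists k', Gam k' x by apply: piece_cover Cx _; rewrite xt.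
  exists k'; have := fkP rt (conj Gx xt).
  by rewrite fx => -[].
- move=> t rt; have [Ct _ nt] := H t rt; exists (h (a, t)) => //; split=> //.
  exact: radial_value_curve H rt.
- exact: radial_value_continuous.
Qed.

End decomposition.

Lemma lambda_gt_ninfty (R : realType) (g : R -> R) :
  cvg ((g t)%:E @[t --> +oo]) -> (-oo < lambda g)%E ->
  exists M, \forall t \near +oo, M <= g t.
Proof.
rewrite /lambda => gc; have : (g t)%:E @[t --> +oo] --> lambda g := gc.
case E : (lambda g) => [a| |] {}gc; rewrite [lim _]E// => _.
  exists (a - 1); move/fine_cvg: gc => gc.
  have a1 : a - 1 < a by rewrite ltrBlDr ltrDl.
  by apply: filterS (cvgr_gt _ gc _ a1) => t /ltW.
move/cvgeyPge: gc => /(_ 0) g0; exists 0; apply: filterS g0 => t.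
by rewrite lee_fin.
Qed.

Theorem theorem4p1 (R : realType) (n : nat)
    (f : 'rV[R]_n -> \bar R) (S : set 'rV[R]_n)
    (f_ninfty : forall x, (-oo < f x)%E)
    (f_lsc : lower_semicontinuous f)
    (f_semialg : semialgebraic_fun f)
    (S_closed : closed S)
    (S_semialg : semialgebraic S)
    (domS_nonempty : edom f `&` S !=set0)
    (domS_unbounded : eunbounded (edom f `&` S))
    (qc : qc_infty f S)
    (l m p : nat) (r : R)
    (C : 'I_l -> set 'rV[R]_n) (F : 'I_l -> set 'rV[R]_m)
    (h : 'rV[R]_m * R -> 'rV[R]_n) (Gam : 'I_p -> set 'rV[R]_n)
    (dec : decomposition_at_infinity f S r C F h Gam)
    (fk : 'I_p -> R -> R)
    (fkP : forall k, radial_value f r (Gam k) (fk k)) :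
  bounded_below_on f S <->
  (-oo < \big[mine/+oo]_(k < p) lambda (fk k))%E.
Proof.
have fk_cvg k : cvg ((fk k t)%:E @[t --> +oo]) :=
  radial_value_cvg dec fkP f_semialg.
split=> [[M fM]|/bigmin_gtP[_ lam]].
  apply/bigmin_gtP; split=> // k _; apply: (@lt_le_trans _ _ M%:E); first exact: ltNyr.
  apply: lime_ge => //; near=> t.
  have rt : r < t by near: t; apply: nbhs_pinfty_gt; exact: num_real.
  have [i [a [_ H]]] := piece_curve dec k; have [Ct _ _] := H t rt.
  rewrite -(radial_value_curve fkP H rt); apply: fM.
  have [[tanE _ _]] := dec_partition dec.
  suff [] : tangency f S (h (a, t)) by [].
  by rewrite -tanE; exists i.
have /choice[Mk Mk_le] k : exists M, \forall t \near +oo, M <= fk k t.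
  by apply: lambda_gt_ninfty => //; exact: lam.
pose M := \big[Num.min/0]_k Mk k.
have [r0 r0_gt0 qcr0] := qc.
have [T rT HT] : exists2 T, Num.max r r0 <= T &
    forall t, T < t -> forall k, M <= fk k t.
  apply: eventually_pinfty_from; apply: filter_forall => k.
  apply: filterS (Mk_le k) => t; apply: le_trans; exact: bigmin_le_cond.
have := rT; rewrite ge_max => /andP[rT1 r0T].
have [B fB] : exists B : R, forall x, (S `&` eball T) x -> (B%:E <= f x)%E.
  apply: lsc_bounded_below_compact => //.
  apply: (@enorm_bounded_compact _ _ _ T) => [|x []//].
  apply: closedI => //.
  by apply: (closed_comp _ (@closed_le R T)) => x _; exact: continuous_enorm.
exists (Num.min M B) => x Sx; have [xT|Tx] := leP (enorm x) T.
  by apply: le_trans (fB x (conj Sx xT)); rewrite lee_fin ge_min lexx orbT.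
rewrite leNgt; apply/negP => fxM.
have [y [ty Ty fyx]] : exists y, [/\ tangency f S y, T < enorm y & (f y <= f x)%E].
  apply: tangency_below => //.
  - move=> z [domSz zT]; apply: qcr0; split=> // zr0; apply: zT.
    exact: le_trans zr0 r0T.
  - exact: lt_le_trans r0T.
  - exact: lt_trans fxM (ltry _).
have [k fy] := tangency_radial_value dec fkP ty (le_lt_trans rT1 Ty).
have := le_lt_trans fyx fxM; rewrite fy lte_fin lt_min => /andP[fkM _].
by have := HT _ Ty k; rewrite leNgt fkM.
Unshelve. all: by end_near. Qed.
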